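(* There exists an absolute constant $c$ such that for all positive integers $n$ and all $\varepsilon\in[1/2^n,1/4]$, $$\mathsf{Q}^{\mathrm{pure},\rightarrow}_{\varepsilon}(\mathsf{EQ}_n)\ge\log\left(\frac{n}{\varepsilon}\right)-\log\log\left(\frac{1}{\varepsilon}\right)-c.$$
   Context: All logarithms are base 2. $\mathsf{EQ}_n:\{0,1\}^n\times\{0,1\}^n\to\{0,1\}$ is the Equality function: $\mathsf{EQ}_n(x,y)=1$ iff $x=y$. A one-way pure-state quantum protocol of cost $\log d$ consists of a unit vector $|\phi_x\rangle\in\mathbb{C}^d$ for each $x\in\{0,1\}^n$ (the message Alice sends on input $x$) and an orthogonal projector $P_y$ on $\mathbb{C}^d$ for each $y\in\{0,1\}^n$ (Bob on input $y$ measures with $\{P_y,I-P_y\}$ and outputs 1 on the first outcome, 0 otherwise). Thus the probability of output 1 on $(x,y)$ is $\|P_y|\phi_x\rangle\|^2$. There is no shared randomness or entanglement. The protocol computes $F:\{0,1\}^n\times\{0,1\}^n\to\{0,1\}$ with error $\varepsilon$ if for every $(x,y)$ the output differs from $F(x,y)$ with probability at most $\varepsilon$. $\mathsf{Q}^{\mathrm{pure},\rightarrow}_{\varepsilon}(F)$ is the minimum of $\log d$ (not rounded to an integer) over all such protocols computing $F$ with error $\varepsilon$. *)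

(* Defs.v *)
From HB Require Import structures.
From mathcomp Require Import all_boot all_order all_algebra.
From mathcomp Require Import sesquilinear spectral complex.
From mathcomp Require Import all_classical all_reals all_analysis.

Set Implicit Arguments.
Unset Strict Implicit.
Unset Printing Implicit Defensive.

Import Order.TTheory GRing.Theory Num.Theory.

Local Open Scope classical_set_scope.
Local Open Scope ring_scope.
Local Open Scope complex_scope.

Definition log2 (R : realType) (x : R) : R := ln x / ln 2.

Definition EQ (n : nat) (x y : n.-tuple bool) : bool := x == y.

Definition sqnorm (R : realType) (d : nat) (v : 'cV[R[i]]_d) : R :=
  \sum_(i < d) ComplexField.Normc.normc (v i 0) ^+ 2.

(* Orthogonal projector: self-adjoint and idempotent. *)
Definition orthoprojector (R : realType) (d : nat) (P : 'M[R[i]]_d) : Prop :=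
  P \is hermsymmx /\ P *m P = P.

(* The dimension 0 is excluded by [msg_unit], as C^0 has no unit vector. *)
Record protocol (R : realType) (n d : nat) := Protocol {
  msg : n.-tuple bool -> 'cV[R[i]]_d;
  meas : n.-tuple bool -> 'M[R[i]]_d;
  msg_unit : forall x, sqnorm (msg x) = 1;
  meas_proj : forall y, orthoprojector (meas y) }.

Definition prob_output1 (R : realType) (n d : nat) (p : protocol R n d)
    (x y : n.-tuple bool) : R :=
  sqnorm (meas p y *m msg p x).

Definition prob_error (R : realType) (n d : nat) (p : protocol R n d)
    (F : n.-tuple bool -> n.-tuple bool -> bool) (x y : n.-tuple bool) : R :=
  if F x y then 1 - prob_output1 p x y else prob_output1 p x y.

Definition computes (R : realType) (n d : nat) (p : protocol R n d)
    (F : n.-tuple bool -> n.-tuple bool -> bool) (eps : R) : Prop :=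
  forall x y, prob_error p F x y <= eps.

Definition costs (R : realType) (n : nat) (eps : R)
    (F : n.-tuple bool -> n.-tuple bool -> bool) : set R :=
  [set log2 d%:R | d in [set d : nat |
     exists p : protocol R n d, computes p F eps]].

(* For 0 <= eps this infimum is a minimum: see [Qpure_min] below. *)
Definition Qpure (R : realType) (n : nat) (eps : R)
    (F : n.-tuple bool -> n.-tuple bool -> bool) : R :=
  inf (costs eps F).

Section minimum.
Variables (R : realType) (n : nat) (F : n.-tuple bool -> n.-tuple bool -> bool).

Lemma sqnorm0 d : sqnorm (0 : 'cV[R[i]]_d) = 0.
Proof.
by rewrite /sqnorm big1 // => i _; rewrite mxE ComplexField.Normc.normc0 expr0n.
Qed.

Lemma sqnorm_delta d (i : 'I_d) : sqnorm (delta_mx i 0 : 'cV[R[i]]_d) = 1.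
Proof.
rewrite /sqnorm (bigD1 i) //= big1 => [|j ji].
  by rewrite mxE !eqxx ComplexField.Normc.normc1 expr1n addr0.
by rewrite mxE (negPf ji) ComplexField.Normc.normc0 expr0n.
Qed.

Let N := #|{: n.-tuple bool}|.

Let basis_msg (x : n.-tuple bool) : 'cV[R[i]]_N := delta_mx (enum_rank x) 0.

Let diag_row (y : n.-tuple bool) : 'rV[R[i]]_N :=
  \row_i (F (enum_val i) y)%:R.

Let diag_meas (y : n.-tuple bool) : 'M[R[i]]_N := diag_mx (diag_row y).

Let basis_msg_unit x : sqnorm (basis_msg x) = 1.
Proof. exact: sqnorm_delta. Qed.

Let diag_meas_proj y : orthoprojector (diag_meas y).
Proof.
split.
  apply/is_hermitianmxP; rewrite expr0 scale1r; apply/matrixP => i j.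
  rewrite !mxE eq_sym; case: (eqVneq j i) => [->|_]; rewrite ?mulr1n ?mulr0n.
    by rewrite rmorph_nat.
  by rewrite rmorph0.
rewrite /diag_meas mulmx_diag; congr diag_mx; apply/rowP => i.
by rewrite !mxE -natrM mulnb andbb.
Qed.

Lemma costs_neq0 (eps : R) : 0 <= eps -> costs eps F !=set0.
Proof.
move=> eps0; exists (log2 N%:R); exists N => //.
exists (Protocol basis_msg_unit diag_meas_proj) => x y.
suff -> : prob_error (Protocol basis_msg_unit diag_meas_proj) F x y = 0 by [].
have E : diag_meas y *m basis_msg x = (F x y)%:R *: basis_msg x.
  apply/colP => i; rewrite mul_diag_mx !mxE.
  by case: eqVneq => [->|_]; rewrite ?enum_rankK // !mulr0.
rewrite /prob_error /prob_output1 /= E.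
by case: (F x y); rewrite ?scale1r ?scale0r ?sqnorm0 ?basis_msg_unit ?subrr.
Qed.

Lemma Qpure_min (eps : R) : 0 <= eps ->
  costs eps F (Qpure eps F) /\ lbound (costs eps F) (Qpure eps F).
Proof.
move=> /costs_neq0 [_ [d0 Hd0 _]].
pose D : pred nat := fun d => `[< exists p : protocol R n d, computes p F eps >].
have exD : exists d, D d by exists d0; exact/asboolP.
have [d /asboolP Hd dmin] := ex_minnP exD.
have dgt0 : (0 < d)%N.
  have [p _] := Hd; case: d p {Hd dmin} => // p.
  have /eqP := msg_unit p [tuple of nseq n false].
  by rewrite /sqnorm big_ord0 eq_sym oner_eq0.
have lb : lbound (costs eps F) (log2 d%:R).
  move=> _ [k Hk <-]; have dk : (d <= k)%N by apply: dmin; exact/asboolP.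
  rewrite /log2 ler_pM2r ?invr_gt0 ?ln_gt0 ?ltr1n //.
  by rewrite ler_ln ?ler_nat // posrE ltr0n // (leq_trans dgt0).
have mem : costs eps F (log2 d%:R) by exists d.
suff -> : Qpure eps F = log2 d%:R by [].
apply/eqP; rewrite eq_le; apply/andP; split.
  by apply: ge_inf => //; exists (log2 d%:R).
by apply: lb_le_inf => //; exists (log2 d%:R).
Qed.

End minimum.

(* Main.v *)
(* Since Bob's projector for [y] nearly fixes the message of [y] and nearly
   annihilates that of [x], distinct messages have squared overlap at most
   [q = 4 eps (1 - eps) <= 3/4]. Their [k]-th symmetric powers are [2^n] unit
   vectors of squared overlap at most [q^k] in a space of dimension
   [D = 'C(d + k - 1, k)], so that the Welch bound gives [1 <= 2 D q^k] as long
   as [2^n q^k >= 1]. The largest [k] with [2^n eps^k >= 1] is of order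
   [n / log (1 / eps)], and [D <= t^-k (1 - t)^-d] with [t = 7/6 q] turns the
   Welch bound into [k = O(eps d)], absorbing the factor 2 by means of the case
   [k = 1], i.e. [1 <= 2 d q]. *)
Require Import Defs.
From mathcomp Require Import all_boot all_order all_algebra.
From mathcomp Require Import sesquilinear spectral complex.
From mathcomp Require Import all_classical all_reals all_analysis.
From mathcomp Require Import ring lra.
Set Implicit Arguments.
Unset Strict Implicit.
Unset Printing Implicit Defensive.

Import Order.TTheory GRing.Theory Num.Theory.
Local Open Scope ring_scope.

(** * Gram matrices, symmetric powers and the Welch bound *)

Section Welch.
Variable C : numClosedFieldType.

Definition dotc n (u v : 'cV[C]_n) : C := \sum_(i < n) u i 0 * (v i 0)^*.

Lemma dotc_CauchySchwarz n (u v : 'cV[C]_n) :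
  `|dotc u v| ^+ 2 <= dotc u u * dotc v v.
Proof.
have E (a b : 'cV[C]_n) : dotc a b = dotmx a^T b^T.
  by rewrite dotmxE mxE; apply: eq_bigr => i _; rewrite !mxE.
by rewrite !E; exact: (CauchySchwarz (@dotmx C n) u^T v^T).1.
Qed.

Variable T : finType.

(** Positive semidefinite kernels of rank at most [D]. The closure properties of this class stand in
    for an explicit construction of symmetric powers. *)
Definition gram_of (D : nat) (K : T -> T -> C) : Prop :=
  exists psi : T -> 'cV[C]_D, forall x y, K x y = dotc (psi x) (psi y).

Lemma gram_ofD D1 D2 K1 K2 : gram_of D1 K1 -> gram_of D2 K2 ->
  gram_of (D1 + D2) (fun x y => K1 x y + K2 x y).
Proof.
move=> [f1 E1] [f2 E2]; exists (fun x => col_mx (f1 x) (f2 x)) => x y.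
rewrite E1 E2 /dotc big_split_ord /=; congr (_ + _); apply: eq_bigr => i _.
  by rewrite !col_mxEu.
by rewrite !col_mxEd.
Qed.

Lemma gram_of_sum m (D : nat -> nat) (K : nat -> T -> T -> C) :
  (forall j, gram_of (D j) (K j)) ->
  gram_of (\sum_(j < m) D j) (fun x y => \sum_(j < m) K j x y).
Proof.
move=> KD; elim: m => [|m IH].
  by rewrite big_ord0; exists (fun=> 0) => x y; rewrite /dotc !big_ord0.
rewrite big_ord_recr; have [f E] := gram_ofD IH (KD m).
by exists f => x y; rewrite big_ord_recr -E.
Qed.

Lemma gram_ofZ D K (g : T -> C) : gram_of D K ->
  gram_of D (fun x y => g x * (g y)^* * K x y).
Proof.
move=> [f E]; exists (fun x => g x *: f x) => x y.
rewrite E /dotc mulr_sumr; apply: eq_bigr => i _.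
by rewrite !mxE rmorphM /= mulrACA.
Qed.

Lemma gram_ofMn D K c : gram_of D K -> gram_of D (fun x y => K x y *+ c).
Proof.
move=> /(gram_ofZ (fun=> sqrtC c%:R)) [f E]; exists f => x y; rewrite -E.
rewrite conj_Creal ?ger0_real ?sqrtC_ge0 ?ler0n //.
by rewrite -expr2 sqrtCK mulr_natl.
Qed.

(* Equals ['C(d + k - 1, k)], the dimension of the [k]-th symmetric power. *)
Fixpoint symdim (d k : nat) : nat :=
  if d is d'.+1 then \sum_(j < k.+1) symdim d' j else (k == 0)%N.

(** Splitting off the first coordinate and expanding binomially gives, for each [j <= k], a rank-one
    kernel times a [j]-th power in one dimension less, which is the recursion of [symdim]. *)
Lemma gram_of_exp d (phi : T -> 'cV[C]_d) k :
  gram_of (symdim d k) (fun x y => dotc (phi x) (phi y) ^+ k).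
Proof.
elim: d phi k => [|d IH] phi k.
  case: k => [|k] /=; [exists (fun=> const_mx 1)|exists (fun=> 0)] => x y.
    by rewrite expr0 /dotc big_ord_recl big_ord0 !mxE conjC1 mulr1 addr0.
  by rewrite /dotc !big_ord0 expr0n.
pose g x := phi x 0 0; pose phi' x := \col_i phi x (lift ord0 i) 0.
have E x y : dotc (phi x) (phi y) = g x * (g y)^* + dotc (phi' x) (phi' y).
  rewrite /dotc big_ord_recl; congr (_ + _).
  by apply: eq_bigr => i _; rewrite !mxE.
have KD j : gram_of (symdim d j) (fun x y =>
    g x ^+ (k - j) * (g y ^+ (k - j))^* * dotc (phi' x) (phi' y) ^+ j *+ 'C(k, j)).
  apply: gram_ofMn; apply: (gram_ofZ (fun x => g x ^+ (k - j))); exact: IH.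
have [f fE] := gram_of_sum k.+1 KD.
exists f => x y; rewrite -fE E exprDn; apply: eq_bigr => i _.
by rewrite exprMn rmorphXn.
Qed.

(* The Gram matrix and the frame operator [M] share their Frobenius norm and
   trace, and the trace of the [D]-by-[D] matrix [M] obeys Cauchy-Schwarz. *)
Lemma Welch_bound D K : gram_of D K -> (forall x, K x x = 1) ->
  #|T|%:R ^+ 2 <= D%:R * \sum_x \sum_y `|K x y| ^+ 2.
Proof.
move=> [f E] K1; pose M i j := \sum_x f x i 0 * (f x j 0)^*.
have trM : \sum_i M i i = #|T|%:R.
  rewrite /M exchange_big /= -sum1_card natr_sum; apply: eq_bigr => x _.
  by rewrite -(K1 x) E.
have frobM : \sum_x \sum_y `|K x y| ^+ 2 = \sum_i \sum_j `|M i j| ^+ 2.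
  transitivity (\sum_x \sum_y \sum_i \sum_j
      (f x i 0 * (f x j 0)^* * (f y i 0 * (f y j 0)^*)^*)).
    apply: eq_bigr => x _; apply: eq_bigr => y _.
    rewrite E normCK /dotc rmorph_sum mulr_suml; apply: eq_bigr => i _.
    rewrite mulr_sumr; apply: eq_bigr => j _.
    by rewrite !rmorphM /= !conjCK; ring.
  under eq_bigr => x _.
    rewrite exchange_big /=.
    under eq_bigr => i _ do rewrite exchange_big /=.
    over.
  rewrite exchange_big /=; apply: eq_bigr => i _.
  rewrite exchange_big /=; apply: eq_bigr => j _.
  rewrite normCK /M rmorph_sum mulr_suml; apply: eq_bigr => x _.
  by rewrite mulr_sumr.
(* The trace is the inner product of the diagonal with the all-ones vector, whose squared norm is
   [D]. *)
have := dotc_CauchySchwarz (\col_i M i i) (const_mx 1).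
have -> : dotc (\col_i M i i) (const_mx 1) = #|T|%:R.
  by rewrite -trM; apply: eq_bigr => i _; rewrite !mxE conjC1 mulr1.
have -> : dotc (const_mx 1 : 'cV[C]_D) (const_mx 1) = D%:R.
  rewrite /dotc (eq_bigr (fun=> 1)) => [|i _]; last by rewrite !mxE conjC1 mulr1.
  by rewrite sumr_const card_ord.
rewrite normr_nat mulrC => /le_trans; apply; rewrite ler_wpM2l ?ler0n //.
rewrite frobM; apply: ler_sum => i _; rewrite !mxE -normCK (bigD1 i) //= lerDl.
by apply: sumr_ge0 => j _; rewrite exprn_ge0.
Qed.

(** With [N] the size of [T], the diagonal contributes [N] to the Welch sum and the rest at most
    [N ^ 2 * eta], so [N <= D * (1 + N * eta) <= 2 * D * N * eta]. *)
Lemma gram_of_dim_ge D K eta : gram_of D K -> (forall x, K x x = 1) ->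
  (forall x y, x != y -> `|K x y| ^+ 2 <= eta) ->
  0 <= eta -> 1 <= #|T|%:R * eta -> 1 <= 2 * D%:R * eta.
Proof.
move=> KD K1 Keta eta0 Neta; have := Welch_bound KD K1; set N := #|T|%:R.
have N0 : 0 < N.
  by rewrite ltr0n lt0n; apply: contraTneq Neta => ->; rewrite mul0r ler10.
have S : \sum_x \sum_y `|K x y| ^+ 2 <= \sum_(x : T) (1 + N * eta).
  apply: ler_sum => x _; rewrite (bigD1 x) //= K1 normr1 expr1n lerD2l.
  apply: (@le_trans _ _ (\sum_(y : T | y != x) eta)).
    by apply: ler_sum => y yx; apply: Keta; rewrite eq_sym.
  rewrite sumr_const -mulr_natl ler_wpM2r // ler_nat; exact: max_card.
move=> /le_trans /(_ (ler_wpM2l (ler0n _ D) S)).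
rewrite sumr_const -(mulr_natl (1 + N * eta)) -/N => /le_trans.
have S2 : D%:R * (N * (1 + N * eta)) <= N * (2 * D%:R * eta * N).
  have -> : N * (2 * D%:R * eta * N) = D%:R * (N * (N * eta + N * eta)) by ring.
  by rewrite ler_wpM2l ?ler0n // ler_pM2l // lerD2r.
by move=> /(_ _ S2); rewrite expr2 ler_pM2l // ler_pMl.
Qed.

End Welch.

(** * Overlaps between the messages of a protocol *)

Section Protocol.
Variables (R : realType) (d : nat).
Implicit Types (u v : 'cV[R[i]%C]_d) (P : 'M[R[i]%C]_d).
Local Notation normc := ComplexField.Normc.normc.

Lemma dotc_sqnorm v : dotc v v = (sqnorm v)%:C%C.
Proof. by rewrite rmorph_sum; apply: eq_bigr => i _; rewrite -normCK rmorphXn. Qed.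

Lemma sqnorm_CauchySchwarz u v :
  normc (dotc u v) ^+ 2 <= sqnorm u * sqnorm v.
Proof.
by have := dotc_CauchySchwarz u v; rewrite !dotc_sqnorm -rmorphM -rmorphXn lecR.
Qed.

Lemma sqnorm_ge0 v : 0 <= sqnorm v.
Proof. by apply: sumr_ge0 => i _; rewrite sqr_ge0. Qed.

Lemma dotcDl u u' v : dotc (u + u') v = dotc u v + dotc u' v.
Proof. by rewrite -big_split; apply: eq_bigr => i _; rewrite !mxE mulrDl. Qed.

Lemma dotcDr u v v' : dotc u (v + v') = dotc u v + dotc u v'.
Proof. by rewrite -big_split; apply: eq_bigr => i _; rewrite !mxE rmorphD mulrDr. Qed.

Lemma dotc_hermitian P u v : P \is hermsymmx -> dotc (P *m u) v = dotc u (P *m v).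
Proof.
move=> /is_hermitianmxP; rewrite expr0 scale1r => hP; rewrite /dotc.
under eq_bigr => i _ do rewrite mxE mulr_suml.
rewrite exchange_big /=; apply: eq_bigr => j _.
rewrite mxE rmorph_sum mulr_sumr; apply: eq_bigr => i _.
by rewrite {1}hP !mxE rmorphM /=; ring.
Qed.

(** The cross terms vanish because [P] is self-adjoint and annihilates [w - P *m w]. *)
Lemma dotc_projector_split P u v : orthoprojector P ->
  dotc u v = dotc (P *m u) (P *m v) + dotc (u - P *m u) (v - P *m v).
Proof.
move=> [hP PP]; have E w w' : dotc (P *m w) (w' - P *m w') = 0.
  rewrite dotc_hermitian // mulmxBr mulmxA PP subrr /dotc big1 // => i _.
  by rewrite mxE conjC0 mulr0.
have E' : dotc (u - P *m u) (P *m v) = 0.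
  rewrite -dotc_hermitian // mulmxBr mulmxA PP subrr /dotc big1 // => i _.
  by rewrite mxE mul0r.
have D (c w : 'cV[R[i]%C]_d) : c + (w - c) = w by rewrite addrC subrK.
have -> : dotc u v = dotc (P *m u) (P *m v) + dotc (P *m u) (v - P *m v) +
    (dotc (u - P *m u) (P *m v) + dotc (u - P *m u) (v - P *m v)).
  by rewrite -!dotcDr -dotcDl !D.
by rewrite E E' addr0 add0r.
Qed.

(** If [a], [b], [eps] are the squared sines of acute angles, then [r + s] is at most the sine of
    the sum of the first two angles, hence at most the sine of twice the third. The proof avoids
    angles by AM-GM. *)
Lemma sqr_addr_le (r s a b eps : R) : 0 <= r -> 0 <= s ->
  0 <= a <= eps -> 0 <= b <= eps -> eps <= 1 / 4 ->
  r ^+ 2 <= a * (1 - b) -> s ^+ 2 <= (1 - a) * b ->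
  (r + s) ^+ 2 <= 4 * eps * (1 - eps).
Proof.
move=> r0 s0 /andP[a0 ae] /andP[b0 be] e4 hr hs.
(* AM-GM for [a * (1 - a)] and [b * (1 - b)], whose product bounds [(r * s) ^ 2]. *)
have rs : 2 * (r * s) <= a * (1 - a) + b * (1 - b).
  have h0 : 0 <= a * (1 - a) + b * (1 - b).
    by rewrite addr_ge0 // mulr_ge0 //; lra.
  rewrite -ler_sqr ?nnegrE ?mulr_ge0 //.
  apply: (@le_trans _ _ (4 * ((a * (1 - b)) * ((1 - a) * b)))).
    rewrite -[(2 * (r * s)) ^+ 2]/(2 * (r * s) * (2 * (r * s))).
    rewrite [leLHS](_ : _ = 4 * (r ^+ 2 * s ^+ 2)); last by ring.
    by rewrite ler_wpM2l // ler_pM ?sqr_ge0.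
  rewrite -subr_ge0 [leRHS](_ : _ = (a * (1 - a) - b * (1 - b)) ^+ 2) ?sqr_ge0 //.
  by ring.
(* The function [t * (2 - t)] increases up to [t = 1]; it is compared at [a + b] and at
   [2 * eps]. *)
have h : 0 <= (2 * eps - (a + b)) * (2 - (a + b) - 2 * eps).
  by rewrite mulr_ge0 //; lra.
by move: h rs hr hs; rewrite sqrrD -mulr_natl; nra.
Qed.

Variables (n : nat) (p : protocol R n d).

Lemma msg_overlap (eps : R) x y : computes p (@EQ n) eps -> eps <= 1 / 4 ->
  x != y -> normc (dotc (msg p x) (msg p y)) ^+ 2 <= 4 * eps * (1 - eps).
Proof.
move=> hp e4 xy; set u := msg p x; set v := msg p y; set P := meas p y.
have hP : orthoprojector P := meas_proj p y.
have split_norm w : sqnorm w = sqnorm (P *m w) + sqnorm (w - P *m w).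
  apply: complexI; rewrite rmorphD /= -!dotc_sqnorm; exact: dotc_projector_split.
have := hp x y; rewrite /prob_error /prob_output1 /EQ (negPf xy) -/u -/P => hu.
have := hp y y; rewrite /prob_error /prob_output1 /EQ eqxx -/v -/P => hv.
have u1 := split_norm u; have v1 := split_norm v.
rewrite (msg_unit p x) in u1; rewrite (msg_unit p y) in v1.
have CS1 := sqnorm_CauchySchwarz (P *m u) (P *m v).
have CS2 := sqnorm_CauchySchwarz (u - P *m u) (v - P *m v).
have tri := @le_normcD R (dotc (P *m u) (P *m v))
  (dotc (u - P *m u) (v - P *m v)).
rewrite -dotc_projector_split // in tri.
have n0 (z : R[i]%C) : 0 <= normc z by rewrite -lecR; exact: (normr_ge0 z).
apply: (@le_trans _ _ ((normc (dotc (P *m u) (P *m v)) +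
    normc (dotc (u - P *m u) (v - P *m v))) ^+ 2)).
  by rewrite ler_sqr ?nnegrE ?addr_ge0.
have nb := sqnorm_ge0 (v - P *m v).
(* Here [a] is the error on [(x, y)] and [b] the error on [(y, y)]. *)
apply: (@sqr_addr_le _ _ (sqnorm (P *m u)) (1 - sqnorm (P *m v))) => //.
- by rewrite sqnorm_ge0.
- by rewrite hv andbT v1 addrAC subrr add0r.
- by rewrite opprB addrC subrK.
have <- : sqnorm (u - P *m u) = 1 - sqnorm (P *m u) by rewrite u1 addrAC subrr add0r.
by have <- : sqnorm (v - P *m v) = 1 - sqnorm (P *m v) by rewrite v1 addrAC subrr add0r.
Qed.

(** A general [D] lets this serve both the symmetric powers and the case [k = 1], [D = d]. *)
Lemma dim_ge_of_gram (eps : R) D k : computes p (@EQ n) eps -> 0 <= eps <= 1 / 4 ->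
  gram_of D (fun x y => dotc (msg p x) (msg p y) ^+ k) ->
  1 <= 2 ^+ n * (4 * eps * (1 - eps)) ^+ k ->
  1 <= 2 * D%:R * (4 * eps * (1 - eps)) ^+ k.
Proof.
move=> hp /andP[e0 e4] hD hk; set q := 4 * eps * (1 - eps).
have q0 : 0 <= q by rewrite !mulr_ge0 //; lra.
have := @gram_of_dim_ge _ _ _ _ ((q ^+ k)%:C%C) hD.
rewrite card_tuple card_bool => H.
have : 1 <= 2 * D%:R * (q ^+ k)%:C%C.
  apply: H.
  - by move=> x; rewrite dotc_sqnorm msg_unit expr1n.
  - move=> x y xy; rewrite normrX exprAC -!rmorphXn lecR lerXn2r ?nnegrE ?sqr_ge0 //.
    exact: msg_overlap.
  - by rewrite ler0c exprn_ge0.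
  - rewrite natrX -(rmorph_nat (real_complex R)) -rmorphXn -rmorphM.
    by rewrite -(rmorph1 (real_complex R)) lecR.
rewrite -!(rmorph_nat (real_complex R)) -!rmorphM.
by rewrite -(rmorph1 (real_complex R)) lecR.
Qed.

End Protocol.

(** * Estimates for the dimension of symmetric powers *)

(* [(1 - t)^-d] is the generating function of [symdim d]. *)
Lemma symdim_le (R : realType) (t : R) d k : 0 <= t <= 1 ->
  (symdim d k)%:R * t ^+ k * (1 - t) ^+ d <= 1.
Proof.
move=> /andP[t0 t1]; elim: d k => [|d IH] k.
  rewrite expr0 mulr1; case: k => [|k] /=; first by rewrite mulr1.
  by rewrite mul0r ler01.
elim: k => [|k IHk].
  have := IH 0%N; rewrite /= big_ord_recr big_ord0 /= add0n !expr0 !mulr1 => h.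
  rewrite exprS mulrCA -[leRHS]mulr1 ler_pM //; first lra.
    by rewrite mulr_ge0 ?ler0n // exprn_ge0 //; lra.
  lra.
rewrite [symdim _ _]/= big_ord_recr natrD.
have := IH k.+1; have := IHk; rewrite [symdim d.+1 k]/=.
set A := (\sum_(_ < _) _)%:R; set B := (symdim d k.+1)%:R => h1 h2.
(* Pascal's rule turns the left side into a convex combination, with weights [t] and [1 - t], of the
   two quantities bounded by induction. *)
rewrite (_ : _ * _ = t * (A * t ^+ k * (1 - t) ^+ d.+1) +
  (1 - t) * (B * t ^+ k.+1 * (1 - t) ^+ d)); last by rewrite !exprS; ring.
rewrite -[leRHS](subrK t) addrC lerD //.
  by rewrite -[leRHS]mulr1 ler_wpM2l //; lra.
by rewrite -[leRHS]mulr1 ler_wpM2l.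
Qed.

(* With [t = 7/6 q], [1 <= 2 D q^k] and [D t^k (1 - t)^d <= 1] give
   [(7/6)^k (1 - t)^d <= 2], while [- ln (1 - t)] is [O(q)]. *)
Lemma symdim_log (R : realType) (q : R) d k : 0 < q <= 3 / 4 ->
  1 <= 2 * (symdim d k)%:R * q ^+ k -> 1 <= 2 * d%:R * q ->
  k%:R * ln (7 / 6) <= 12 * q * d%:R.
Proof.
move=> /andP[q0 q34] hD hd.
(* The ratio [7 / 6] exceeds 1 yet keeps [t <= 7 / 8], away from 1. The existential makes [t]
   opaque. *)
have [t tE] : exists t, t = 7 / 6 * q by exists (7 / 6 * q).
have t0 : 0 < t by lra.
have t1 : 0 < 1 - t by lra.
have hsym : (symdim d k)%:R * t ^+ k * (1 - t) ^+ d <= 1.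
  by apply: symdim_le; apply/andP; split; lra.
have hpow : (7 / 6) ^+ k * (1 - t) ^+ d <= 2.
  have w0 : 0 <= (7 / 6) ^+ k * (1 - t) ^+ d.
    by rewrite mulr_ge0 // exprn_ge0 // ltW.
  have := ler_wpM2r w0 hD; rewrite mul1r => /le_trans; apply.
  rewrite [leLHS](_ : _ = 2 * ((symdim d k)%:R * t ^+ k * (1 - t) ^+ d)).
    by rewrite ler_piMr.
  by rewrite tE (exprMn k (7 / 6) q); move: ((7 / 6) ^+ k) => c; ring.
have hln : k%:R * ln (7 / 6) + d%:R * ln (1 - t) <= ln 2.
  have p76 : 0 < 7 / 6 :> R by rewrite divr_gt0.
  rewrite (mulr_natl (ln (7 / 6))) (mulr_natl (ln (1 - t))) -!lnXn //.
  rewrite -lnM ?posrE ?exprn_gt0 //.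
  by rewrite ler_ln ?posrE ?mulr_gt0 ?exprn_gt0.
(* For [t <= 7 / 8], [1 / (1 - t) <= 1 + 8 * t], and [8 * t = 28 / 3 * q <= 10 * q]. *)
have ln1t : - ln (1 - t) <= 10 * q.
  rewrite -lnV ?posrE //.
  have V0 : 0 < (1 - t)^-1 by rewrite invr_gt0.
  have V8 : (1 - t)^-1 <= 8 * t + 1.
    rewrite -[leLHS]mul1r ler_pdivrMr // -subr_ge0.
    rewrite (_ : _ - _ = t * (7 - 8 * t)); last by ring.
    by rewrite mulr_ge0 //; lra.
  have := @le_ln1Dx R ((1 - t)^-1 - 1).
  have -> : 1 + ((1 - t)^-1 - 1) = (1 - t)^-1 by rewrite addrC subrK.
  move=> H.
  apply: le_trans (H _) _; first by lra.
  by clear -V8 tE q0; lra.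
have ln21 : ln (2 : R) <= 1.
  by have := @le_ln1Dx R 1; rewrite -[1 + 1]/2; apply; exact: lt_trans (ltrN10 R) ltr01.
have h2 : d%:R * - ln (1 - t) <= d%:R * (10 * q) by rewrite ler_wpM2l ?ler0n.
(* Since [ln 2 <= 1 <= 2 * d * q], the factor 2 costs [2 * q * d], whence [12 = 10 + 2]. *)
by clear -hln hd ln21 h2; lra.
Qed.

(** * Choice of the power and the final bound *)

Lemma dim_lower_bound (R : realType) (n d : nat) (eps : R) (p : protocol R n d) :
  (0 < n)%N -> 1 / 2 ^+ n <= eps <= 1 / 4 -> computes p (@EQ n) eps ->
  n%:R / log2 (1 / eps) * ln (7 / 6) <= 96 * eps * d%:R.
Proof.
move=> n0 /andP[en e4] hp; set q := 4 * eps * (1 - eps).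
have e0 : 0 < eps by apply: lt_le_trans en; rewrite divr_gt0 ?exprn_gt0.
have qe : eps <= q by rewrite /q; nra.
have q4 : q <= 4 * eps by rewrite /q; nra.
have q34 : q <= 3 / 4 by rewrite /q; nra.
have q0 : 0 < q := lt_le_trans e0 qe.
have q034 : 0 < q <= 3 / 4 by rewrite q0.
have e1 : 0 <= eps <= 1 / 4 by rewrite ltW.
have ln20 : 0 < ln (2 : R) by rewrite ln_gt0 // ltr1n.
have eV1 : 1 < eps^-1 by rewrite invf_gt1 //; lra.
have L0 : 0 < ln eps^-1 by rewrite ln_gt0.
have l76 : 0 < ln (7 / 6 : R) by rewrite ln_gt0 //; lra.
have eVn : eps^-1 <= 2 ^+ n by rewrite invf_ple ?posrE ?exprn_gt0 // -[_^-1]mul1r.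
(* The real solution of [2 ^ n * eps ^ z = 1]; it is at least 1 because [eps >= 1 / 2 ^ n]. *)
set z := n%:R * ln 2 / ln eps^-1.
have z1 : 1 <= z.
  rewrite ler_pdivlMr // mul1r [n%:R * _]mulr_natl -lnXn //.
  by rewrite ler_ln ?posrE ?invr_gt0 ?exprn_gt0.
set k := Num.truncn z.
have /andP[kz zk] : k%:R <= z < k.+1%:R by apply: truncn_itv; lra.
have k1 : 1 <= k%:R :> R.
  by rewrite ler1n -ltnS -(ltr_nat R) (le_lt_trans z1).
have hk : 1 <= 2 ^+ n * q ^+ k.
  apply: (@le_trans _ _ (2 ^+ n * eps ^+ k)); last first.
    by rewrite ler_wpM2l ?exprn_ge0 // lerXn2r ?nnegrE // ltW.
  rewrite -ler_pdivrMr ?exprn_gt0 // mul1r -exprVn.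
  rewrite -ler_ln ?posrE ?exprn_gt0 ?invr_gt0 // !lnXn ?invr_gt0 //.
  by rewrite -(mulr_natl (ln eps^-1)) -(mulr_natl (ln 2)) -ler_pdivlMr.
have hD := dim_ge_of_gram hp e1 (gram_of_exp (msg p) k) hk.
have hd : 1 <= 2 * d%:R * q.
  rewrite -[q]expr1; apply: (dim_ge_of_gram hp e1); first by exists (msg p).
  rewrite expr1 -/q; apply: (@le_trans _ _ (2 ^+ n * eps)).
    by rewrite mulrC -ler_pdivrMr ?exprn_gt0.
  by rewrite ler_wpM2l ?exprn_ge0.
have main : k%:R * ln (7 / 6) <= 48 * eps * d%:R.
  apply: le_trans (symdim_log q034 hD hd) _.
  by rewrite ler_wpM2r // -[48]/((12 * 4)%:R) natrM -mulrA ler_wpM2l.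
have -> : n%:R / log2 (1 / eps) = z.
  by rewrite /log2 /z div1r invf_div mulrA.
(* As [k >= 1], rounding [z] down loses at most a factor 2; this doubles 48 to 96. *)
have zk2 : z <= 2 * k%:R.
  by apply: le_trans (ltW zk) _; rewrite -natr1 [2 * _]mulr_natl mulr2n lerD2l.
apply: le_trans (ler_wpM2r (ltW l76) zk2) _; rewrite -[leLHS]mulrA.
rewrite [leRHS](_ : _ = 2 * (48 * eps * d%:R)); last by ring.
by rewrite ler_wpM2l.
Qed.

Theorem theorem1p10 (R : realType) :
  exists c : R, forall (n : nat) (eps : R),
    (0 < n)%N -> 1 / 2 ^+ n <= eps <= 1 / 4 ->
    log2 (n%:R / eps) - log2 (log2 (1 / eps)) - c <= Qpure eps (@EQ n).
Proof.
have l76 : 0 < ln (7 / 6 : R) by rewrite ln_gt0 //; lra.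
have ln20 : 0 < ln (2 : R) by rewrite ln_gt0 // ltr1n.
exists (log2 (96 / ln (7 / 6))) => n eps n0 he; have /andP[en e4] := he.
have e0 : 0 < eps by apply: lt_le_trans en; rewrite divr_gt0 ?exprn_gt0.
(* The infimum is attained, so it suffices to bound the dimension of one optimal protocol. *)
have [[d [p hp] <-] _] := Qpure_min (@EQ n) (ltW e0).
have h := dim_lower_bound n0 he hp.
have l1e : 0 < ln (1 / eps) by rewrite ln_gt0 // div1r invf_gt1 //; lra.
have L0 : 0 < log2 (1 / eps) by rewrite divr_gt0.
have n0' : 0 < n%:R :> R by rewrite ltr0n.
rewrite /log2 -!mulrBl ler_pM2r ?invr_gt0 // -/(log2 _).
rewrite -!ln_div ?posrE ?divr_gt0 //.
(* The logarithms on the left, constant included, merge into that of the single quotient [m]. *)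
set m := n%:R / eps / _ / _.
have m0 : 0 < m by rewrite !divr_gt0.
suff hm : m <= d%:R by rewrite ler_ln ?posrE // (lt_le_trans m0).
have -> : m = n%:R / log2 (1 / eps) * ln (7 / 6) / (96 * eps).
  rewrite /m; move: (log2 (1 / eps)) L0 (ln (7 / 6)) l76 => L L0 l l0.
  by field; rewrite !gt_eqF.
by rewrite ler_pdivrMr ?mulr_gt0 // [leRHS]mulrC.
Qed.
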